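(* Let $\langle L,\sqsubseteq\rangle$ be a lattice with join operator $\sqcup$. Consider the following implementation of generalized lattice agreement over $L$ from an atomic snapshot object in the dynamic system described in the context: each node $p$ keeps a local variable $val$ (the join of all its inputs so far), and on $\mathrm{Propose}_p(v)$ it sets $val:=val\sqcup v$, performs $\mathrm{Update}_p(val)$, performs $sview:=\mathrm{Scan}_p()$, and returns the join of all lattice values appearing in $sview$. Let $v_i^p$ and $w_i^p$ denote the input and the response of $p$'s $i$-th Propose. Then: (Validity) every response $w_i^p$ is the join of some values proposed before this response, including $v_i^p$ and all values returned to any node before the invocation of $p$'s $i$-th Propose; (Consistency) any two responses $w_i^p$ and $w_j^q$ are comparable under $\sqsubseteq$; (Termination) each Propose invoked at a node that does not crash or leave terminates, within $O(N)$ collects and stores on the underlying store-collect object, where $N$ is the maximum number of nodes concurrently active during the execution of that Propose.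
   Context: **System.** Asynchronous message-passing system with churn. Nodes may enter, leave and crash; a node is present at time $t$ if it has entered and not left by $t$ (crashed nodes remain present), active if present and not crashed; $N(t)$ is the number of present nodes. There are constants $\alpha>0$, $0<\Delta\le1$, $D>0$, $N_{min}\geq 1$ such that at most $\alpha N(t)$ nodes enter or leave in $[t,t+D]$ for every $t>0$, at most $\Delta N(t)$ nodes are crashed at any time $t$, and $N(t)\ge N_{min}$. The parameters satisfy, for some $\gamma,\beta\in(0,1]$ and with $Z=(1-\alpha)^3-\Delta(1+\alpha)^3$: $Z+\gamma-(1+\alpha)^3>0$, $N_{min}\ge 1/(Z+\gamma-(1+\alpha)^3)$, $\gamma\le Z/(1+\alpha)^3$, $\beta\le Z/(1+\alpha)^2$, $\beta>\frac{(1-Z)(1+\alpha)^5+(1+\alpha)^6}{((1-\alpha)^3-\Delta(1+\alpha)^2)((1+\alpha)^2+1)}$. Each node has at most one pending operation at a time, and invokes operations only after joining and before leaving or crashing. **Atomic snapshot object.** Operations $\mathrm{Update}_p(v)$ (returns Ack) and $\mathrm{Scan}_p()$ (returns a set of (node id, value) pairs without duplicate ids). Sequential specification: the view returned by a Scan contains, for each node $p$, the value of the last preceding Update by $p$ if there is one, and no value for $p$ otherwise. The object used is linearizable, and is implemented on top of a store-collect object (operations $\mathrm{Store}_p(v)$, and $\mathrm{Collect}_p$ returning a view with the latest stored value of each node) so that each Scan or Update invoked by a node that remains active terminates using at most $O(N(t))$ store and collect operations, $t$ being the time the operation starts. *)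

(* Defs.v *)
From mathcomp Require Import all_boot all_order all_algebra.
From mathcomp Require Import finmap.
From mathcomp Require Import boolp classical_sets cardinality reals.

Set Implicit Arguments.
Unset Strict Implicit.
Unset Printing Implicit Defensive.

Import Order.TTheory GRing.Theory Num.Theory.

Local Open Scope classical_set_scope.
Local Open Scope fmap_scope.
Local Open Scope ring_scope.

(* A lattice need not have a bottom, so the join of no values is [None]. *)
Definition joino d (L : latticeType d) (o : option L) (v : L) : option L :=
  Some (if o is Some u then Order.join u v else v).

Definition joins d (L : latticeType d) (s : seq L) : option L :=
  foldl (@joino d L) None s.

(* A view is a finite map, that is, a finite set of (node id, value) pairs
   without duplicate ids.  [S] is the type of the values that the snapshot
   implementation keeps in the store-collect object. *)
Inductive action d (L : latticeType d) (node : choiceType) (S : Type) : Type :=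
| Enter (p : node)
| Join (p : node)
| Leave (p : node)
| Crash (p : node)
| InvPropose (p : node) (v : L)
| RetPropose (p : node) (w : L)
| InvUpdate (p : node) (u : L)
| AckUpdate (p : node)
| InvScan (p : node)
| RetScan (p : node) (V : {fmap node -> L})
| InvStore (p : node) (x : S)
| AckStore (p : node)
| InvCollect (p : node)
| RetCollect (p : node) (X : {fmap node -> S})
| Other. (* anything else, e.g. the sending or the receipt of a message *)

Arguments Enter {d L node S} p.
Arguments Join {d L node S} p.
Arguments Leave {d L node S} p.
Arguments Crash {d L node S} p.
Arguments InvPropose {d L node S} p v.
Arguments RetPropose {d L node S} p w.
Arguments InvUpdate {d L node S} p u.
Arguments AckUpdate {d L node S} p.
Arguments InvScan {d L node S} p.
Arguments RetScan {d L node S} p V.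
Arguments InvStore {d L node S} p x.
Arguments AckStore {d L node S} p.
Arguments InvCollect {d L node S} p.
Arguments RetCollect {d L node S} p X.
Arguments Other {d L node S}.

Section Actions.
Context {d : Order.disp_t} {L : latticeType d} {node : choiceType} {S : Type}.
Implicit Types (p : node) (a : action L node S).

Definition actor a : option node :=
  match a with
  | Enter p | Join p | Leave p | Crash p
  | InvPropose p _ | RetPropose p _ | InvUpdate p _ | AckUpdate p
  | InvScan p | RetScan p _ | InvStore p _ | AckStore p
  | InvCollect p | RetCollect p _ => Some p
  | Other => None
  end.

Definition propose_inv p a := if a is InvPropose q _ then q == p else false.
Definition propose_ret p a := if a is RetPropose q _ then q == p else false.

Definition snap_inv p a :=
  match a with InvUpdate q _ | InvScan q => q == p | _ => false end.
Definition snap_ret p a :=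
  match a with AckUpdate q | RetScan q _ => q == p | _ => false end.

Definition store_inv p a := if a is InvStore q _ then q == p else false.
Definition store_ret p a := if a is AckStore q then q == p else false.
Definition collect_inv p a := if a is InvCollect q then q == p else false.
Definition collect_ret p a := if a is RetCollect q _ then q == p else false.

(* Status of the current Update or Scan with respect to store-collect. *)
Inductive sc_phase : Type := Quiet | Storing | Collecting.

Inductive phase : Type :=
| Idle
| ToUpdate
| Updating (c : sc_phase)
| ToScan
| Scanning (c : sc_phase)
| ToReturn (sview : {fmap node -> L}).

(* [Halted] means that the node has left or crashed. *)
Inductive lstate : Type :=
| Outside
| Entered
| Member (val : option L) (ph : phase)
| Halted.

Definition alive (s : lstate) : bool :=
  match s with Entered | Member _ _ => true | Outside | Halted => false end.

Inductive sc_step p : sc_phase -> action L node S -> sc_phase -> Prop :=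
| sc_store x : sc_step p Quiet (InvStore p x) Storing
| sc_ack : sc_step p Storing (AckStore p) Quiet
| sc_collect : sc_step p Quiet (InvCollect p) Collecting
| sc_view X : sc_step p Collecting (RetCollect p X) Quiet.

(* In a given phase only the actions listed here are possible.  In particular a
   Propose is invoked only by a joined node, with no pending Propose. *)
Inductive step p : lstate -> action L node S -> lstate -> Prop :=
| step_enter : step p Outside (Enter p) Entered
| step_join : step p Entered (Join p) (Member None Idle)
| step_leave s : alive s -> step p s (Leave p) Halted
| step_crash s : alive s -> step p s (Crash p) Halted
| step_propose val v :
    step p (Member val Idle) (InvPropose p v) (Member (joino val v) ToUpdate)
| step_update u :
    step p (Member (Some u) ToUpdate) (InvUpdate p u)
           (Member (Some u) (Updating Quiet))
| step_update_sc val c a c' : sc_step p c a c' ->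
    step p (Member val (Updating c)) a (Member val (Updating c'))
| step_ack val :
    step p (Member val (Updating Quiet)) (AckUpdate p) (Member val ToScan)
| step_scan val :
    step p (Member val ToScan) (InvScan p) (Member val (Scanning Quiet))
| step_scan_sc val c a c' : sc_step p c a c' ->
    step p (Member val (Scanning c)) a (Member val (Scanning c'))
| step_view val V :
    step p (Member val (Scanning Quiet)) (RetScan p V) (Member val (ToReturn V))
| step_return val V w : joins (codomf V) = Some w ->
    step p (Member val (ToReturn V)) (RetPropose p w) (Member val Idle)
| step_other s a : actor a != Some p -> step p s a s.

(* The steps that a node takes by itself, without waiting for the client or for
   the snapshot object. *)
Definition local_act p a : bool :=
  match a with
  | InvUpdate q _ | InvScan q | RetPropose q _ => q == p
  | _ => false
  end.

End Actions.

Arguments phase {d} L node.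
Arguments lstate {d} L node.

(* The n-th event is [act n] and occurs at time [time n]; [st n p] is the local
   state of [p] just before it.  Events are totally ordered by their index, also
   when they are simultaneous.  A finite execution is padded with [Other].
   Initially present nodes enter, and join, at time 0. *)
Record execution (R : realType) d (L : latticeType d) (node : choiceType)
    (S : Type) : Type := Execution {
  time : nat -> R;
  act : nat -> action L node S;
  st : nat -> node -> lstate L node }.

Section Executions.
Context {R : realType} {d : Order.disp_t} {L : latticeType d}
        {node : choiceType} {S : Type}.
Implicit Types (e : execution R L node S) (p q : node) (t : R).

Definition timed e : Prop :=
  [/\ forall n, 0 <= time e n,
      forall m n, (m <= n)%N -> time e m <= time e n
    & forall t, exists n, t < time e n].

Definition follows_code e : Prop :=
  (forall p, st e 0 p = Outside) /\
  (forall n p, step p (st e n p) (act e n) (st e n.+1 p)).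

Definition never_fails e p : Prop :=
  forall n, act e n <> Leave p /\ act e n <> Crash p.

(* A node that neither leaves nor crashes eventually takes an enabled local
   step. *)
Definition locally_fair e : Prop :=
  forall n p (a : action L node S) s,
  never_fails e p -> local_act p a -> step p (st e n p) a s ->
  exists2 m, (n <= m)%N & local_act p (act e m).

(* The event of index [j] is the response to the invocation of index [k]. *)
Definition matching e (inv ret : pred (action L node S)) (k j : nat) : Prop :=
  [/\ (k < j)%N, inv (act e k), ret (act e j)
    & forall m, (k < m < j)%N -> ~~ ret (act e m)].

Definition snap_op e p := matching e (snap_inv p) (snap_ret p).
Definition propose_op e p := matching e (propose_inv p) (propose_ret p).
Definition store_op e p := matching e (store_inv p) (store_ret p).
Definition collect_op e p := matching e (collect_inv p) (collect_ret p).

Definition sc_count e p (k j : nat) : nat :=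
  (\sum_(k <= n < j | store_inv p (act e n) || collect_inv p (act e n)) 1)%N.

Definition by_time e t (a : action L node S) : Prop :=
  exists2 n, time e n <= t & act e n = a.

Definition present e t : set node :=
  [set p | by_time e t (Enter p) /\ ~ by_time e t (Leave p)].
Definition crashed e t : set node := [set p | by_time e t (Crash p)].
Definition active e t : set node := present e t `\` crashed e t.

Definition churning e t D : set node :=
  [set p | exists2 n, t <= time e n <= t + D &
                      act e n = Enter p \/ act e n = Leave p].

(* All the sets measured below are finite in a [timed] execution, which has
   finitely many events up to any given time. *)
Definition card (A : set node) : nat := #|` fset_set A |.

Definition bounded_churn (alpha Delta D : R) (Nmin : nat) e : Prop :=
  [/\ forall t, 0 < t ->
        (card (churning e t D))%:R <= alpha * (card (present e t))%:R,
      forall t, 0 <= t ->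
        (card (crashed e t))%:R <= Delta * (card (present e t))%:R
    & forall t, 0 <= t -> (Nmin <= card (present e t))%N].

(* The value collected for [q] was stored by [q] before the end of the Collect,
   and is not older than the last Store of [q] completed before its start. *)
Definition store_collect_regular e : Prop :=
  forall p k j X, collect_op e p k j -> act e j = RetCollect p X ->
  forall q,
    match X.[? q] with
    | None => forall k' j', store_op e q k' j' -> ~ (j' < k)%N
    | Some x => exists k', [/\ (k' < j)%N, act e k' = InvStore q x
        & forall k2 j2, store_op e q k2 j2 -> (k' < k2)%N -> ~ (j2 < k)%N]
    end.

(* Operations are identified by the index of their invocation. *)
Definition last_update e q (s : seq nat) : option L :=
  foldl (fun o k => if act e k is InvUpdate r u
                    then if r == q then Some u else o else o) None s.

(* [s] is a linearization of the history made of the first [n] events.  It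
   contains all completed operations and possibly some pending ones; as usual
   the latter may be completed by any response. *)
Definition linearization e (n : nat) (s : seq nat) : Prop :=
  [/\ uniq s,
      forall k, k \in s -> (k < n)%N /\ exists p, snap_inv p (act e k),
      forall p k j, snap_op e p k j -> (j < n)%N -> k \in s,
      forall p k j k', snap_op e p k j -> (j < k')%N -> k \in s -> k' \in s ->
        (index k s < index k' s)%N
    & forall p k j V, snap_op e p k j -> (j < n)%N -> act e j = RetScan p V ->
        forall q, V.[? q] = last_update e q (take (index k s) s)].

Definition snapshot_linearizable e : Prop :=
  forall n, exists s, linearization e n s.

Definition snapshot_terminating (C : nat) e : Prop :=
  forall p k, snap_inv p (act e k) -> never_fails e p ->
  exists2 j, snap_op e p k j &
    (sc_count e p k j <= C * card (present e (time e k)))%N.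

(* [C] is the constant hidden in the O(N(t)) cost of Update and Scan. *)
Record gla_execution (alpha Delta D : R) (Nmin C : nat) e : Prop := {
  gla_timed : timed e;
  gla_churn : bounded_churn alpha Delta D Nmin e;
  gla_code : follows_code e;
  gla_fair : locally_fair e;
  gla_store_collect : store_collect_regular e;
  gla_linearizable : snapshot_linearizable e;
  gla_snap_terminating : snapshot_terminating C e }.

(* [xs] lists (by index) some Propose invocations, and [w] is the join of their
   inputs. *)
Definition join_of_proposals e (xs : seq nat) (w : L) : Prop :=
  exists2 vs : seq L, joins vs = Some w &
    size vs = size xs /\
    forall i, (i < size xs)%N ->
      exists p, act e (nth 0%N xs i) = InvPropose p (nth w vs i).

(* A previously returned value is in general not an input but a join of inputs:
   it is included in [w] as the join of some of the inputs that make up [w]. *)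
Definition validity e : Prop :=
  forall p k j w, propose_op e p k j -> act e j = RetPropose p w ->
  exists xs : seq nat,
    [/\ join_of_proposals e xs w,
        forall x, x \in xs -> (x < j)%N,
        k \in xs
      & forall q r w', (r < k)%N -> act e r = RetPropose q w' ->
          exists2 ys, {subset ys <= xs} & join_of_proposals e ys w'].

Definition consistency e : Prop :=
  forall p q i j w w', act e i = RetPropose p w -> act e j = RetPropose q w' ->
  (w <= w')%O \/ (w' <= w)%O.

Definition max_active e (t t' : R) (N : nat) : Prop :=
  (exists2 u, t <= u <= t' & card (active e u) = N) /\
  (forall u, t <= u <= t' -> (card (active e u) <= N)%N).

Definition termination (K : nat) e : Prop :=
  forall p k, propose_inv p (act e k) -> never_fails e p ->
  exists2 j, propose_op e p k j &
    exists2 N, max_active e (time e k) (time e j) N &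
      (sc_count e p k j <= K * N)%N.

End Executions.

Definition Zparam (R : realType) (alpha Delta : R) : R :=
  (1 - alpha) ^+ 3 - Delta * (1 + alpha) ^+ 3.

Record admissible (R : realType) (alpha Delta D gamma beta : R) (Nmin : nat)
    : Prop := {
  alpha_gt0 : 0 < alpha;
  Delta_bounds : 0 < Delta <= 1;
  D_gt0 : 0 < D;
  Nmin_ge1 : (1 <= Nmin)%N;
  gamma_bounds : 0 < gamma <= 1;
  beta_bounds : 0 < beta <= 1;
  slack_gt0 : 0 < Zparam alpha Delta + gamma - (1 + alpha) ^+ 3;
  Nmin_large : (Zparam alpha Delta + gamma - (1 + alpha) ^+ 3)^-1 <= Nmin%:R;
  gamma_le : gamma <= Zparam alpha Delta / (1 + alpha) ^+ 3;
  beta_le : beta <= Zparam alpha Delta / (1 + alpha) ^+ 2;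
  beta_gt :
    ((1 - Zparam alpha Delta) * (1 + alpha) ^+ 5 + (1 + alpha) ^+ 6)
      / (((1 - alpha) ^+ 3 - Delta * (1 + alpha) ^+ 2)
         * ((1 + alpha) ^+ 2 + 1)) < beta }.

(* Main.v *)
(* Every Update of a node writes the join of all its inputs so far, so the values
   of successive Updates of one node increase and a linearization lists them in
   program order.  Hence a response is the join of all inputs that precede, at
   their own node, some Update linearized before the Scan, and this set of inputs
   grows with the position of the Scan in the linearization: two responses are
   comparable.  A Propose that starts after a response scans later, so it joins all
   the inputs joined by that response.  For the cost, [Delta < 1] follows from
   [0 < Zparam], whence the number of present nodes is at most a constant times
   the number of active ones. *)
From mathcomp Require Import all_boot all_order all_algebra.
From mathcomp Require Import finmap.
From mathcomp Require Import boolp classical_sets cardinality reals ring.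
Require Import Defs.

Set Implicit Arguments.
Unset Strict Implicit.
Unset Printing Implicit Defensive.

Import Order.TTheory GRing.Theory Num.Theory.

Local Open Scope fmap_scope.

(** * Joins of finite sequences as least upper bounds *)

Section Joins.
Context {d : Order.disp_t} {L : latticeType d}.
Implicit Types (s : seq L) (w z : L).

Lemma joins_rcons s v : joins (rcons s v) = joino (joins s) v.
Proof. by rewrite /joins foldl_rcons. Qed.

(** Universal property of the join, by induction from the right because [joins] is a left fold. It
    reduces inequalities between joins to membership. *)
Lemma joins_le s w z : joins s = Some w -> (w <= z)%O = all (<= z)%O s.
Proof.
elim/last_ind: s w => [//|s v IHs] w; rewrite joins_rcons all_rcons => -[<-].
case: (lastP s) IHs => [|s' x] IHs; first by rewrite andbT.
by move: IHs; rewrite joins_rcons /joino => IHs; rewrite leUx (IHs _ erefl) andbC.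
Qed.

Lemma joins_neq_nil s : s != [::] -> exists w, joins s = Some w.
Proof. by case/lastP: s => [//|s v] _; rewrite joins_rcons; eexists. Qed.

Lemma joins_mem s w : joins s = Some w -> exists v, v \in s.
Proof. by case: s => [//|v s] _; exists v; rewrite mem_head. Qed.

Lemma joinsP s w :
  s != [::] -> (forall z, (w <= z)%O = all (<= z)%O s) -> joins s = Some w.
Proof.
move=> /joins_neq_nil[w' jw'] lub_w; rewrite jw'; congr Some.
by apply/le_anti; rewrite (joins_le w jw') -lub_w lexx lub_w -(joins_le w' jw') lexx.
Qed.

End Joins.

(** * Transitions of a single node *)

Section Steps.
Context {d : Order.disp_t} {L : latticeType d} {node : choiceType} {S : Type}.
Implicit Types (p q : node) (a : action L node S) (s : lstate L node).

Lemma snap_inv_actor p a : snap_inv p a -> actor a = Some p.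
Proof. by case: a => //= q; [move=> _|]; move/eqP->. Qed.

Lemma snap_ret_actor p a : snap_ret p a -> actor a = Some p.
Proof. by case: a => //= q; [|move=> _]; move/eqP->. Qed.

Lemma propose_inv_actor p a : propose_inv p a -> actor a = Some p.
Proof. by case: a => //= q _ /eqP->. Qed.

Lemma propose_ret_actor p a : propose_ret p a -> actor a = Some p.
Proof. by case: a => //= q _ /eqP->. Qed.

Lemma sc_inv_actor p a : store_inv p a || collect_inv p a -> actor a = Some p.
Proof. by case: a => //= q; [move=> _; rewrite orbF|]; move/eqP->. Qed.

Lemma local_act_actor p a : local_act p a -> actor a = Some p.
Proof. by case: a => //= q; [move=> _|move=> _|]; move/eqP->. Qed.

(** [Halted] counts as busy: a node that leaves or crashes during an operation leaves it pending and
    never invokes another one. *)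
Definition busy s : bool :=
  match s with
  | Member _ (Updating _) | Member _ (Scanning _) | Halted => true
  | _ => false
  end.

Lemma step_snap_inv p s a s' :
  step p s a s' -> snap_inv p a -> ~~ busy s && busy s'.
Proof.
case=> //= [_ c b c'|_ c b c'|{}s b /eqP nb /snap_inv_actor/nb //]; by case.
Qed.

Lemma step_busy p s a s' :
  step p s a s' -> busy s -> ~~ snap_ret p a -> busy s'.
Proof. by case=> //= [_|_ _]; rewrite eqxx. Qed.

(** The phases whose next step is local, hence subject to [locally_fair]. *)
Definition waiting s : bool :=
  match s with
  | Member _ ToUpdate | Member _ ToScan | Member _ (ToReturn _) => true
  | _ => false
  end.

Lemma step_waiting p s a s' : step p s a s' -> waiting s ->
  [\/ local_act p a, a = Leave p, a = Crash p
    | s' = s /\ actor a != Some p].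
Proof.
case=> //= *; rewrite ?eqxx; solve [ by constructor 1 | by constructor 2
  | by constructor 3 | by constructor 4 ].
Qed.

Lemma step_propose_inv p s a s' : step p s a s' -> propose_inv p a ->
  exists u, s' = Member (Some u) ToUpdate.
Proof.
case=> //= [val v _|val c b c' [] //|val c b c' [] //|r b /eqP nact].
  by eexists.
by move=> /propose_inv_actor.
Qed.

Lemma step_local p s a s' : step p s a s' -> local_act p a ->
  match s with
  | Member _ ToUpdate =>
      exists u, a = InvUpdate p u /\ s' = Member (Some u) (Updating Quiet)
  | Member val ToScan => a = InvScan p /\ s' = Member val (Scanning Quiet)
  | Member _ (ToReturn V) => exists w, a = RetPropose p w
  | _ => True
  end.
Proof.
case=> //= [u _|_ V w _ _|r b /eqP nact /local_act_actor //].
  by exists u.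
by exists w.
Qed.

End Steps.

(** * Snapshot operations of one node along an execution *)

Section Executions.
Context {R : realType} {d : Order.disp_t} {L : latticeType d}
        {node : choiceType} {S : Type}.
Variable e : execution R L node S.
Hypothesis code : follows_code e.
Implicit Types (p q : node) (a : action L node S).

Let stepP n p : step p (st e n p) (act e n) (st e n.+1 p).
Proof. by case: code. Qed.

Lemma forall_ltnS (P : nat -> Prop) l n : (forall m, l <= m < n -> P m) ->
  P n -> forall m, l <= m < n.+1 -> P m.
Proof.
move=> Pm Pn m; rewrite ltnS (leq_eqVlt m) => /andP[am /orP[/eqP->//|mn]].
by apply: Pm; rewrite am.
Qed.

(** Induction on [n]: the node is busy from the invocation on, and only a response of its own can
    end this. *)
Lemma earlier_snap_op p n k : k < n -> snap_inv p (act e k) ->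
  (exists2 j, snap_op e p k j & j < n) \/
  busy (st e n p) /\ forall m, k < m < n -> ~~ snap_ret p (act e m).
Proof.
move=> + inv_k; elim: n => [//|n IHn]; rewrite ltnS leq_eqVlt.
case/orP=> [/eqP eq_kn|lt_kn].
  right; rewrite -eq_kn; have /andP[_ ->] := step_snap_inv (stepP k p) inv_k.
  by split=> // m /andP[km]; rewrite ltnS leqNgt km.
case: (IHn lt_kn) => [[j opj ltj]|[busy_n quiet]].
  by left; exists j => //; apply: ltnW.
have [ret_n|nret_n] := boolP (snap_ret p (act e n)).
  by left; exists n.
right; split; first exact: step_busy (stepP n p) _ _.
exact: forall_ltnS.
Qed.

(** Program order: an invocation needs a node that is not busy, which excludes that the earlier
    operation is still pending. *)
Lemma snap_op_before p k k' : k < k' ->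
  snap_inv p (act e k) -> snap_inv p (act e k') ->
  exists2 j, snap_op e p k j & j < k'.
Proof.
move=> lt_k inv_k inv_k'; case: (earlier_snap_op lt_k inv_k) => // -[busy_k' _].
by have := step_snap_inv (stepP k' p) inv_k'; rewrite busy_k'.
Qed.

(** The absence of a Propose of [p] from [ku] on ties the Update to the current Propose without
    naming the latter. *)
Definition update_since p n ku : Prop :=
  [/\ ku < n, exists u, act e ku = InvUpdate p u
    & forall m, ku <= m < n -> ~~ propose_inv p (act e m)].

Lemma update_sinceS p n ku : update_since p n ku ->
  ~~ propose_inv p (act e n) -> update_since p n.+1 ku.
Proof.
by case=> lt_ku upd fresh nprop; split=> //; [exact: ltnW | exact: forall_ltnS].
Qed.

(** Invariant indexed by the phase: it records what the local state alone forgets about the Update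
    and the Scan of the current Propose. *)
Definition history p n (s : lstate L node) : Prop :=
  match s with
  | Member _ (Updating _) | Member _ ToScan => exists ku, update_since p n ku
  | Member _ (Scanning _) => exists ku ks,
      [/\ update_since p n ku, ku < ks < n, act e ks = InvScan p
        & forall m, ks < m < n -> ~~ snap_ret p (act e m)]
  | Member _ (ToReturn V) => exists ku ks js,
      [/\ update_since p n ku, ku < ks, snap_op e p ks js, js < n
        & act e js = RetScan p V]
  | _ => True
  end.

Lemma historyP p n : history p n (st e n p).
Proof.
elim: n => [|n]; first by case: code => ->.
move: (stepP n p).
move: (st e n p) (st e n.+1 p) => s s'; move Ea: (act e n) => a Hs.
case: s a s' / Hs Ea => //=.
- move=> u Ea _; exists n; split=> //; first by exists u.
  by move=> m; rewrite ltnS -eqn_leq => /eqP<-; rewrite Ea.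
- move=> val c a c' Hsc Ea [ku Hku]; exists ku.
  by apply: update_sinceS => //; rewrite Ea; case: Hsc.
- by move=> val Ea [ku Hku]; exists ku; apply: update_sinceS => //; rewrite Ea.
- move=> val Ea [ku Hku]; exists ku, n; split=> //.
  + by apply: update_sinceS => //; rewrite Ea.
  + by case: Hku => ->; rewrite /=.
  + by move=> m /andP[km]; rewrite ltnS leqNgt km.
- move=> val c a c' Hsc Ea [ku [ks [Hku /andP[kus ksn] Es nret]]].
  exists ku, ks; split=> //.
  + by apply: update_sinceS => //; rewrite Ea; case: Hsc.
  + by rewrite kus ltnW.
  + by apply: forall_ltnS => //; rewrite Ea; case: Hsc.
- move=> val V Ea [ku [ks [Hku /andP[kus ksn] Es nret]]].
  exists ku, ks, n; split=> //; first by apply: update_sinceS => //; rewrite Ea.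
  by split=> //; rewrite ?Es ?Ea /=.
- move=> s a /eqP nact Ea.
  have nprop : ~~ propose_inv p (act e n).
    by rewrite Ea; apply/negP => /propose_inv_actor/nact.
  case: s => //= val [] //=.
  + by move=> _ [ku Hku]; exists ku; apply: update_sinceS.
  + by move=> [ku Hku]; exists ku; apply: update_sinceS.
  + move=> _ [ku [ks [Hku /andP[kus ksn] Es nret]]].
    exists ku, ks; split=> //; first exact: update_sinceS.
      by rewrite kus ltnW.
    by apply: forall_ltnS => //; rewrite Ea; apply/negP => /snap_ret_actor/nact.
  + move=> V [ku [ks [js [Hku kus op_s jsn Es]]]].
    by exists ku, ks, js; split=> //; [exact: update_sinceS | exact: ltnW].
Qed.

(** * Inputs of a node and the values it writes *)

Definition proposal p x : option L :=
  if act e x is InvPropose q v then if q == p then Some v else None else None.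

Definition proposals p n : seq L := pmap (proposal p) (iota 0 n).

Lemma proposalsS p n :
  proposals p n.+1 = proposals p n ++ seq_of_opt (proposal p n).
Proof. by rewrite /proposals -addn1 iotaD pmap_cat /= add0n; case: proposal. Qed.

Lemma mem_proposals p n v :
  reflect (exists2 x, x < n & act e x = InvPropose p v) (v \in proposals p n).
Proof.
rewrite mem_pmap; apply: (iffP mapP) => [[x]|[x xn Ex]].
  rewrite mem_iota add0n => xn Ev; exists x => //; move: Ev; rewrite /proposal.
  by case: act => // q w; case: eqP => // -> [->].
by exists x; rewrite ?mem_iota // /proposal Ex eqxx.
Qed.

(** Invariant of the variable [val]. Before joining, the list of inputs must be empty, since joining
    starts [val] at [None], the join of no values; a halted node writes nothing more. *)
Lemma val_proposals p n :
  match st e n p with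
  | Outside | Entered => proposals p n = [::]
  | Member val _ => val = joins (proposals p n)
  | Halted => True
  end.
Proof.
elim: n => [|n]; first by case: code => ->.
have nil_app (s : seq L) : s ++ seq_of_opt None = s by rewrite cats0.
rewrite proposalsS; move: (stepP n p); rewrite [proposal p n]/proposal.
move: (st e n p) (st e n.+1 p) (act e n) => s s' a Hs.
case: s a s' / Hs => //=; rewrite ?nil_app //.
- by move=> ->.
- by move=> val v; rewrite eqxx /= cats1 joins_rcons => <-.
- by move=> val c a c' [] *; rewrite nil_app.
- by move=> val c a c' [] *; rewrite nil_app.
- move=> s a /eqP nact.
  have -> : (if a is InvPropose q v then if q == p then Some v else None
             else None) = None.
    by case: a nact => //= q v nact; case: eqP nact => // ->.
  by rewrite nil_app.
Qed.

Lemma update_joins p k u :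
  act e k = InvUpdate p u -> joins (proposals p k) = Some u.
Proof.
move=> Ek; move: (stepP k p) (val_proposals p k); rewrite Ek.
move: (st e k p) (st e k.+1 p) => s s' Hs.
inversion Hs; subst => //=; try by inversion H.
by move: H; rewrite /= eqxx.
Qed.

(** Inputs only accumulate: those made before [k] are among those made before [k']. *)
Lemma update_le p k k' u u' : k <= k' ->
  act e k = InvUpdate p u -> act e k' = InvUpdate p u' -> (u <= u')%O.
Proof.
move=> kk' /update_joins Eu /update_joins Eu'; rewrite (joins_le _ Eu).
apply/allP => v /mem_proposals[x xk Ex].
have := lexx u'; rewrite (joins_le _ Eu') => /allP; apply.
by apply/mem_proposals; exists x => //; apply: leq_trans kk'.
Qed.

(** * What a Scan reads along a linearization *)

Lemma last_updateP q s u' : last_update e q s = Some u' ->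
  exists2 k, k \in s & act e k = InvUpdate q u'.
Proof.
elim/last_ind: s => [//|s x IHs]; rewrite /last_update foldl_rcons.
have weaken : last_update e q s = Some u' ->
    exists2 k, k \in rcons s x & act e k = InvUpdate q u'.
  by case/IHs => k ks Ek; exists k; rewrite ?mem_rcons ?inE ?ks ?orbT.
case Ex: (act e x); try exact: weaken.
case: eqP => [<- [<-]|_]; last exact: weaken.
by exists x; rewrite ?mem_rcons ?mem_head.
Qed.

(** Induction from the right: a final Update of [q] is itself the one read, and any other last
    element changes nothing. *)
Lemma last_update_latest q s k u : uniq s -> k \in s ->
  act e k = InvUpdate q u ->
  exists k' u', [/\ last_update e q s = Some u', act e k' = InvUpdate q u',
    k' \in s & index k s <= index k' s].
Proof.
elim/last_ind: s => [//|s x IHs]; rewrite rcons_uniq => /andP[xs us] ks Ek.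
rewrite /last_update foldl_rcons -/(last_update e q s) -!cats1.
have ix : index x (s ++ [:: x]) = size s.
  by rewrite index_cat (negPf xs) /= eqxx addn0.
have [Ex|nEx] := pselect (exists u', act e x = InvUpdate q u').
  case: Ex => u' Ex; exists x, u'; rewrite Ex eqxx; split=> //.
    by rewrite mem_cat inE eqxx orbT.
  by rewrite ix -ltnS -[X in _ < X]addn1 -(size_cat s [:: x]) index_mem cats1.
have {}ks : k \in s.
  by move: ks; rewrite mem_rcons inE => /orP[/eqP xk|//]; case: nEx; exists u; rewrite -xk.
have [k' [u' [lst Ek' k's le_i]]] := IHs us ks Ek.
exists k', u'; rewrite mem_cat k's !index_cat ks k's; split=> //.
case Ex: (act e x) => [||||||r w||||||||] //; case: eqP => // rq.
by case: nEx; exists w; rewrite Ex rq.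
Qed.

(* The response of a Propose is the join of the inputs [x] for which [joined]
   holds, [s] being the part of a linearization that precedes its Scan. *)
Definition joined (s : seq nat) (x : nat) : Prop :=
  exists q k u v, [/\ k \in s, act e k = InvUpdate q u,
                      act e x = InvPropose q v & x < k].

(** An input joined by an Update before the Scan is below the value read for its node, which comes
    from the same or a later Update; conversely, each value read is a join of such inputs. *)
Lemma view_le n s k p j V w : linearization e n s -> snap_op e p k j -> j < n ->
  act e j = RetScan p V -> joins (codomf V) = Some w ->
  forall z, (w <= z)%O <-> forall x q v, joined (take (index k s) s) x ->
    act e x = InvPropose q v -> (v <= z)%O.
Proof.
case=> us mem_s compl ord vals op_k jn Ej Ew z.
have ks := compl _ _ _ op_k jn; set s' := take _ s.
have us' : uniq s' := take_uniq _ us.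
have Vq : forall q, V.[? q] = last_update e q s' by move=> q; apply: vals Ej _.
have s's i : i \in s' -> i \in s by apply: mem_take.
rewrite (joins_le _ Ew); split=> [/allP le_z x q v|le_z].
- case=> q' [i [u [v' [is' Ei Ex xi]]]]; rewrite Ex => -[_ <-] {q v}.
  have [i' [u' [lst Ei' i's' le_i]]] := last_update_latest us' is' Ei.
  have u'z : (u' <= z)%O by apply: le_z; apply/codomfP; exists q'; rewrite Vq.
  (* Had [i'] been invoked before [i], it would have completed before [i] by program order and so be
     linearized first, against [le_i]. *)
  apply: le_trans u'z; have le_ii' : i <= i'.
    rewrite leqNgt; apply/negP => lt_i'i.
    have [||l op_l li] := @snap_op_before q' i' i lt_i'i.
    - by rewrite Ei' /=.
    - by rewrite Ei /=.
    have := ord _ _ _ _ op_l li (s's _ i's') (s's _ is').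
    have idx b : b \in s' -> index b s = index b s'.
      by move=> bs'; rewrite -{1}(cat_take_drop (index k s) s) index_cat bs'.
    by rewrite !idx // ltnNge le_i.
  apply: le_trans (update_le le_ii' Ei Ei').
  have := lexx u; rewrite (joins_le _ (update_joins Ei)) => /allP; apply.
  by apply/mem_proposals; exists x.
- apply/allP => u /codomfP[q]; rewrite Vq => /last_updateP[i is' Ei] /=.
  rewrite (joins_le _ (update_joins Ei)); apply/allP => v /mem_proposals[x xi Ex].
  by apply: (le_z x q) => //; exists q, i, u, v.
Qed.

(** [L] need not have a bottom, so a join of proposals must range over a nonempty list; any value in
    the view provides an input. *)
Lemma view_joined n s k p j V w : linearization e n s -> snap_op e p k j ->
  j < n -> act e j = RetScan p V -> joins (codomf V) = Some w ->
  exists x, joined (take (index k s) s) x.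
Proof.
case=> _ _ _ _ vals op_k jn Ej Ew.
have [v /codomfP[q]] : exists v, v \in codomf V.
  exact: joins_mem Ew.
rewrite (vals _ _ _ _ op_k jn Ej) => /last_updateP[i is' Ei].
have [x xi Ex] : exists2 x, x < i & exists v, act e x = InvPropose q v.
  have := update_joins Ei; case: (proposals q i) (@mem_proposals q i) => [//|v' vs].
  move=> /(_ v'); rewrite mem_head => /elimT/(_ isT)[x xi Ex] _.
  by exists x => //; exists v'.
by case: Ex => v' Ex; exists x, q, i, v, v'.
Qed.

(** A Propose can return only from the phase [ToReturn], where the invariant supplies the Update and
    the completed Scan. *)
Lemma responseP p j w : act e j = RetPropose p w ->
  exists ku ks js, [/\ update_since p j ku, ku < ks, snap_op e p ks js, js < j
    & exists2 V, act e js = RetScan p V & joins (codomf V) = Some w].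
Proof.
move=> Ej; move: (stepP j p) (historyP p j); rewrite Ej.
move: (st e j p) (st e j.+1 p) => s s' Hs.
inversion Hs; subst => //=; try by inversion H.
  by case=> ku [ks [js [upd kus op_ks jsj Ejs]]]; exists ku, ks, js; split=> //; exists V.
by move: H; rewrite /= eqxx.
Qed.

(** * Validity and consistency *)

Definition joined_seq (s : seq nat) n : seq nat :=
  [seq x <- iota 0 n | `[< joined s x >]].

(** The cutoff [n] loses nothing: a linearization of the first [n] events has only indices below
    [n], and a joined input precedes its Update. *)
Lemma mem_joined_seq n s i x : linearization e n s ->
  x \in joined_seq (take i s) n <-> joined (take i s) x.
Proof.
case=> _ mem_s _ _ _; rewrite mem_filter mem_iota add0n /=.
split=> [/andP[/asboolP //]|Jx]; apply/andP; split; first exact/asboolP.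
case: Jx => q [k [u [v [ks _ _ xk]]]].
by apply: ltn_trans xk _; have [] := mem_s _ (mem_take ks).
Qed.

Lemma join_of_proposalsP (xs : seq nat) w : xs != [::] ->
  (forall x, x \in xs -> exists q v, act e x = InvPropose q v) ->
  (forall z, (w <= z)%O <-> forall x q v, x \in xs ->
     act e x = InvPropose q v -> (v <= z)%O) ->
  join_of_proposals e xs w.
Proof.
move=> xs0 inv_xs lub_w.
(* The default [w] is never taken on [xs], whose members are all Propose invocations. *)
pose f x := if act e x is InvPropose _ v then v else w.
exists (map f xs).
  apply: joinsP; first by case: (xs) xs0.
  move=> z; apply/idP/allP => [/lub_w le_z _ /mapP[x xxs ->]|le_z].
    by have [q [v Ex]] := inv_xs x xxs; rewrite /f Ex; apply: le_z Ex.
  apply/lub_w => x q v xxs Ex; have := le_z (f x) (map_f _ xxs).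
  by rewrite /f Ex.
split=> [|i ilt]; first by rewrite size_map.
have [q [v Ex]] := inv_xs _ (mem_nth 0 ilt).
by exists q; rewrite (nth_map 0) // /f Ex.
Qed.

Lemma scan_join n s k p j V w : linearization e n s -> snap_op e p k j ->
  j < n -> act e j = RetScan p V -> joins (codomf V) = Some w ->
  join_of_proposals e (joined_seq (take (index k s) s) n) w.
Proof.
move=> lin op_k jn Ej Ew; apply: join_of_proposalsP.
- have [x /(mem_joined_seq _ _ lin)] := view_joined lin op_k jn Ej Ew.
  by case: joined_seq.
- by move=> x /(mem_joined_seq _ _ lin)[q [i [u [v []]]]]; exists q, v.
- move=> z; rewrite (view_le lin op_k jn Ej Ew); split=> le_z x q v.
    by move=> /(mem_joined_seq _ _ lin); apply: le_z.
  by move=> /(mem_joined_seq _ _ lin); apply: le_z.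
Qed.

Lemma joined_sub s i i' x : i <= i' -> joined (take i s) x -> joined (take i' s) x.
Proof.
move=> ii' [q [k [u [v [ks Ek Ex xk]]]]]; exists q, k, u, v; split=> //.
by move: ks; rewrite -(take_takel s ii'); apply: mem_take.
Qed.

(** In a linearization of the events before the response, real-time order puts two things before the
    Scan: the node's own Update, which contributes the input [k], and the Scan behind each earlier
    response, whose joined inputs are therefore included. *)
Lemma gla_validity : snapshot_linearizable e -> validity e.
Proof.
move=> lin p k j w [kj inv_k _ _] Ej; have [s lin_s] := lin j.
have [ku [ks [js [[kuj [u Eku] fresh] kus op_ks jsj [V Ejs Ew]]]]] := responseP Ej.
(* Otherwise [k] would lie between [ku] and [j], where [p] invokes no Propose. *)
have k_ku : k < ku.
  rewrite ltnNge; apply/negP => ku_k.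
  by have := fresh k; rewrite ku_k kj inv_k => /(_ isT).
exists (joined_seq (take (index ks s) s) j); split.
- exact: scan_join Ejs Ew.
- by move=> x; rewrite mem_filter mem_iota add0n => /andP[_].
- have [q v Ek] : exists2 q, q = p & exists v, act e k = InvPropose q v.
    by case: (act e k) inv_k => //= q v /eqP->; exists p => //; exists v.
  subst q; case: Ek => v Ek.
  apply/(mem_joined_seq _ _ lin_s); exists p, ku, u, v; split=> //.
  have [ks_js inv_ks _ _] := op_ks.
  have [ju op_ku ju_ks] : exists2 j, snap_op e p ku j & j < ks.
    by apply: snap_op_before; rewrite ?Eku /=.
  case: lin_s => _ _ compl ord _.
  have ku_s : ku \in s by apply: compl op_ku (ltn_trans ju_ks (ltn_trans ks_js jsj)).
  have ks_s : ks \in s by apply: compl op_ks jsj.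
  by rewrite in_take //; apply: ord op_ku ju_ks _ _.
- move=> q r w' rk Er.
  have [ku' [ks' [js' [_ _ op_ks' jsr [V' Ejs' Ew']]]]] := responseP Er.
  have js'j : js' < j by apply: ltn_trans jsr (ltn_trans rk kj).
  exists (joined_seq (take (index ks' s) s) j); last exact: scan_join Ejs' Ew'.
  move=> x /(mem_joined_seq _ _ lin_s) Jx; apply/(mem_joined_seq _ _ lin_s).
  apply: joined_sub Jx; case: lin_s => _ _ compl ord _.
  apply/ltnW/(ord _ _ _ _ op_ks').
  + by apply: ltn_trans kus; apply: ltn_trans k_ku; apply: ltn_trans rk.
  + exact: compl op_ks' js'j.
  + exact: compl op_ks jsj.
Qed.

(** Both Scans lie in one linearization, that of the events before the later response, so the
    prefixes preceding them are nested, and so are the inputs joined. *)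
Lemma gla_consistency : snapshot_linearizable e -> consistency e.
Proof.
move=> lin p q i j w w' Ei Ej; have [s lin_s] := lin (maxn i j).
have [_ [ks [js [_ _ op jsi [V Ejs Ew]]]]] := responseP Ei.
have [_ [ks' [js' [_ _ op' jsj [V' Ejs' Ew']]]]] := responseP Ej.
have lts : js < maxn i j by rewrite leq_max jsi.
have lts' : js' < maxn i j by rewrite leq_max jsj orbT.
have le := view_le lin_s op lts Ejs Ew; have le' := view_le lin_s op' lts' Ejs' Ew'.
case: (leqP (index ks s) (index ks' s)) => [|/ltnW] le_i; [left|right].
- apply/le => x r v Jx Ex; have /le' := lexx w'.
  by apply; [exact: joined_sub le_i Jx | exact: Ex].
- apply/le' => x r v Jx Ex; have /le := lexx w.
  by apply; [exact: joined_sub le_i Jx | exact: Ex].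
Qed.


(** * Termination and the count of store-collect operations *)

Lemma forall_cat (P : nat -> Prop) l n r : (forall m, l <= m < n -> P m) ->
  (forall m, n <= m < r -> P m) -> forall m, l <= m < r -> P m.
Proof.
by move=> Pln Pnr m /andP[lm mr]; case: (leqP n m) => nm;
  [apply: Pnr; rewrite nm | apply: Pln; rewrite lm].
Qed.

Lemma sc_count_cat p l n r : l <= n -> n <= r ->
  sc_count e p l r = sc_count e p l n + sc_count e p n r.
Proof. by move=> ln nr; rewrite /sc_count (big_cat_nat ln nr). Qed.

Lemma sc_count_eq0 p l r :
  (forall m, l <= m < r -> ~~ (store_inv p (act e m) || collect_inv p (act e m))) ->
  sc_count e p l r = 0.
Proof.
move=> no_sc; rewrite /sc_count big_nat_cond big_pred0 // => m.
by apply/negP => /andP[/no_sc/negP].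
Qed.

(** Fairness gives some local step of [p]; before the first one, a waiting node that does not fail
    sees only actions that are not its own. *)
Lemma wait_local p n a s' : locally_fair e -> never_fails e p ->
  waiting (st e n p) -> local_act p a -> step p (st e n p) a s' ->
  exists m, [/\ n <= m, st e m p = st e n p, local_act p (act e m)
              & forall i, n <= i < m -> actor (act e i) != Some p].
Proof.
move=> fair nf wait_n loc_a step_a.
have ex_m : exists m, (n <= m) && local_act p (act e m).
  by have [m nm loc_m] := fair _ _ _ _ nf loc_a step_a; exists m; rewrite nm.
case: (ex_minnP ex_m) => m /andP[nm loc_m] min_m; exists m.
suff /(_ m nm (leqnn m))[? ?] : forall i, n <= i -> i <= m ->
  st e i p = st e n p /\ forall j, n <= j < i -> actor (act e j) != Some p by [].
elim=> [|i IHi]; first by rewrite leqn0 => /eqP-> _; split=> // j; rewrite ltn0 andbF.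
rewrite leq_eqVlt ltnS => /orP[/eqP <- _|ni im].
  by split=> // j /andP[nj]; rewrite ltnNge nj.
have [st_i quiet] := IHi ni (ltnW im).
have wait_i : waiting (st e i p) by rewrite st_i.
case: (step_waiting (stepP i p) wait_i).
- by move=> loc_i; have := min_m i; rewrite loc_i ni leqNgt im => /(_ isT).
- by move=> Ei; case: (nf i) => /(_ Ei).
- by move=> Ei; case: (nf i) => _ /(_ Ei).
- by move=> [-> nact]; split=> //; apply: forall_ltnS.
Qed.

(* [F] is [Updating] or [Scanning], and [G] describes how the operation ends. *)
Lemma run_snap_op (F : sc_phase -> phase L node) (G : lstate L node -> Prop) p :
  (forall val c a s', step p (Member val (F c)) a s' ->
     a <> Leave p -> a <> Crash p ->
     [/\ ~~ snap_ret p a, ~~ propose_ret p a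
       & exists val' c', s' = Member val' (F c')] \/
     [/\ snap_ret p a, ~~ propose_ret p a & G s']) ->
  forall k j val c, never_fails e p -> snap_op e p k j ->
  st e k.+1 p = Member val (F c) ->
  G (st e j.+1 p) /\ forall i, k < i < j.+1 -> ~~ propose_ret p (act e i).
Proof.
move=> stepF k j val c nf [kj _ ret_j quiet] st_k.
(* Before the response the node stays in [F], so the step at [j] is the one that ends the
   operation. *)
suff /(_ j kj (leqnn j))[[val' [c' st_j]] noret] : forall i, k < i -> i <= j ->
    (exists val' c', st e i p = Member val' (F c')) /\
    forall i', k < i' < i -> ~~ propose_ret p (act e i').
  have := stepP j p; rewrite st_j => /stepF; case: (nf j) => nl nc /(_ nl nc).
  by case=> [[]|[_ nret ?]]; rewrite ?ret_j //; split=> //; apply: forall_ltnS.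
elim=> [//|i IHi]; rewrite ltnS leq_eqVlt => /orP[/eqP <- _|ki ij].
  by split=> [|i' /andP[ki']]; [exists val, c | rewrite ltnS leqNgt ki'].
have [[val' [c' st_i]] noret] := IHi ki (ltnW ij).
have := stepP i p; rewrite st_i => /stepF; case: (nf i) => nl nc /(_ nl nc).
case=> [[_ nret st_Si]|[ret_i]]; first by split=> //; apply: forall_ltnS.
by have := quiet i; rewrite ki ij ret_i => /(_ isT).
Qed.

Lemma step_updating p val c a s' : step p (Member val (Updating c)) a s' ->
  a <> Leave p -> a <> Crash p ->
  [/\ ~~ snap_ret p a, ~~ propose_ret p a
    & exists val' c', s' = Member val' (Updating c')] \/
  [/\ snap_ret p a, ~~ propose_ret p a & exists val', s' = Member val' ToScan].
Proof.
move=> Hs nl nc; inversion Hs; subst => //.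
- by left; split; [by case: H3 | by case: H3 | by exists val, c'].
- by right; rewrite /= eqxx; split=> //; exists val.
- left; move/eqP: H => nact; split; last by exists val, c.
    by apply/negP => /snap_ret_actor.
  by apply/negP => /propose_ret_actor.
Qed.

Lemma step_scanning p val c a s' : step p (Member val (Scanning c)) a s' ->
  a <> Leave p -> a <> Crash p ->
  [/\ ~~ snap_ret p a, ~~ propose_ret p a
    & exists val' c', s' = Member val' (Scanning c')] \/
  [/\ snap_ret p a, ~~ propose_ret p a
    & exists val' V, s' = Member val' (ToReturn V)].
Proof.
move=> Hs nl nc; inversion Hs; subst => //.
- by left; split; [by case: H3 | by case: H3 | by exists val, c'].
- by right; rewrite /= eqxx; split=> //; exists val, V.
- left; move/eqP: H => nact; split; last by exists val, c.
    by apply/negP => /snap_ret_actor.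
  by apply/negP => /propose_ret_actor.
Qed.

(** Fairness only concerns enabled steps, so the final return needs a nonempty view. The node's own
    Update completed before its Scan, hence the view has an entry for [p]. *)
Lemma return_enabled p n val V : snapshot_linearizable e ->
  st e n p = Member val (ToReturn V) -> exists w, joins (codomf V) = Some w.
Proof.
move=> lin st_n; have := historyP p n; rewrite st_n /=.
case=> ku [ks [js [[_ [u Eku] _] kus op_ks jsn Ejs]]].
have [s [us _ compl ord vals]] := lin n; have [ks_js inv_ks _ _] := op_ks.
have [ju op_ku ju_ks] : exists2 j, snap_op e p ku j & j < ks.
  by apply: snap_op_before; rewrite ?Eku /=.
have ku_s : ku \in s by apply: compl op_ku (ltn_trans ju_ks (ltn_trans ks_js jsn)).
have ks_s : ks \in s by apply: compl op_ks jsn.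
have ku_t : ku \in take (index ks s) s.
  by rewrite in_take //; apply: ord op_ku ju_ks _ _.
have [_ [u' [lst _ _ _]]] := last_update_latest (take_uniq _ us) ku_t Eku.
apply: joins_neq_nil; have : u' \in codomf V.
  by apply/codomfP; exists p; rewrite (vals _ _ _ _ op_ks jsn Ejs).
by apply: contraL => /eqP V0; rewrite -[u' \in _]/(u' \in (codomf V : seq L)) V0.
Qed.

(** [m1] and [m2] are the invocations of the Update and of the Scan. All stores and collects of [p]
    fall within these two operations, each charged to the nodes present at its own start. *)
Lemma propose_completes C p k : snapshot_linearizable e -> locally_fair e ->
  snapshot_terminating C e -> never_fails e p -> propose_inv p (act e k) ->
  exists j m1 m2, [/\ propose_op e p k j, k <= m1 < j, k <= m2 < j &
    sc_count e p k j <= C * card (present e (time e m1))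
                        + C * card (present e (time e m2))].
Proof.
move=> lin fair term nf inv_k.
have [u st_k] := step_propose_inv (stepP k p) inv_k.
have quiet_k : forall i, k <= i < k.+1 ->
    ~~ (store_inv p (act e i) || collect_inv p (act e i)).
  move=> i; rewrite ltnS -eqn_leq => /eqP <-.
  by case: (act e k) inv_k.
have not_sc i : actor (act e i) != Some p ->
    ~~ (store_inv p (act e i) || collect_inv p (act e i)).
  by apply: contra => /sc_inv_actor/eqP.
have not_ret i : actor (act e i) != Some p -> ~~ propose_ret p (act e i).
  by apply: contra => /propose_ret_actor/eqP.
have ret_not_sc i j : snap_op e p i j -> forall i', j <= i' < j.+1 ->
    ~~ (store_inv p (act e i') || collect_inv p (act e i')).
  move=> [_ _ ret_j _] i'; rewrite ltnS -eqn_leq => /eqP <-.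
  by case: (act e j) ret_j.
have [m1 [k_m1 st_m1 loc1 idle1]] : exists m, [/\ k < m,
    st e m p = Member (Some u) ToUpdate, local_act p (act e m)
    & forall i, k < i < m -> actor (act e i) != Some p].
  rewrite -st_k.
  apply: (wait_local (a := InvUpdate p u) fair nf); rewrite ?st_k //=.
  exact: step_update.
have [u1 [E1 st_Sm1]] : exists u, act e m1 = InvUpdate p u /\
    st e m1.+1 p = Member (Some u) (Updating Quiet).
  by have := step_local (stepP m1 p) loc1; rewrite st_m1.
have [|j1 op1 count1] := term p m1 _ nf; first by rewrite E1 /=.
have [[val st_j1] noret1] := run_snap_op (@step_updating p) nf op1 st_Sm1.
have [m2 [j1_m2 st_m2 loc2 idle2]] : exists m, [/\ j1 < m,
    st e m p = Member val ToScan, local_act p (act e m)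
    & forall i, j1 < i < m -> actor (act e i) != Some p].
  rewrite -st_j1.
  apply: (wait_local (a := InvScan p) fair nf); rewrite ?st_j1 //=.
  exact: step_scan.
have [E2 st_Sm2] : act e m2 = InvScan p /\
    st e m2.+1 p = Member val (Scanning Quiet).
  by have := step_local (stepP m2 p) loc2; rewrite st_m2.
have [|j2 op2 count2] := term p m2 _ nf; first by rewrite E2 /=.
have [[val' [V st_j2]] noret2] := run_snap_op (@step_scanning p) nf op2 st_Sm2.
have [w Ew] := return_enabled lin st_j2.
have [j [j2_j st_j loc_j idle3]] : exists m, [/\ j2 < m,
    st e m p = Member val' (ToReturn V), local_act p (act e m)
    & forall i, j2 < i < m -> actor (act e i) != Some p].
  rewrite -st_j2.
  apply: (wait_local (a := RetPropose p w) fair nf); rewrite ?st_j2 //=.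
  exact: step_return.
have [w' Ej] : exists w, act e j = RetPropose p w.
  by have := step_local (stepP j p) loc_j; rewrite st_j.
have [m1_j1 _ _ _] := op1; have [m2_j2 _ _ _] := op2.
have m1_j2 : m1 < j2 by apply: ltn_trans m1_j1 (ltn_trans j1_m2 m2_j2).
exists j, m1, m2; split.
- split=> //; first by apply: ltn_trans (ltn_trans m1_j2 j2_j).
    by rewrite Ej /=.
  (* No return of Propose occurs before [j]: this is checked in turn on idle stretches, invocations
     and runs of the two operations. *)
  apply: (@forall_cat _ k.+1 m1).
    by move=> i /idle1/not_ret.
  apply: (@forall_cat _ m1 m1.+1).
    by move=> i; rewrite ltnS -eqn_leq => /eqP <-; rewrite E1.
  apply: (@forall_cat _ m1.+1 j1.+1) => //.
  apply: (@forall_cat _ j1.+1 m2).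
    by move=> i /idle2/not_ret.
  apply: (@forall_cat _ m2 m2.+1).
    by move=> i; rewrite ltnS -eqn_leq => /eqP <-; rewrite E2.
  apply: (@forall_cat _ m2.+1 j2.+1) => //.
  by move=> i /idle3/not_ret.
- by rewrite ltnW // (ltn_trans m1_j2).
- by rewrite (ltn_trans m2_j2) // andbT ltnW // (ltn_trans k_m1) // (ltn_trans m1_j1).
have k_m1' := ltnW k_m1; have m1_j1' := ltnW m1_j1; have j1_m2' := ltnW j1_m2.
have m2_j2' := ltnW m2_j2; have j2_j' := ltnW j2_j.
(* The count splits into five stretches; those before the Update, between the operations and after
   the Scan contribute zero. *)
rewrite (sc_count_cat p k_m1' (leq_trans m1_j1' (leq_trans j1_m2' (leq_trans m2_j2' j2_j')))).
rewrite (sc_count_cat p m1_j1' (leq_trans j1_m2' (leq_trans m2_j2' j2_j'))).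
rewrite (sc_count_cat p j1_m2' (leq_trans m2_j2' j2_j')) (sc_count_cat p m2_j2' j2_j').
rewrite [sc_count e p k m1]sc_count_eq0; last first.
  by apply: forall_cat quiet_k _ => i /idle1/not_sc.
rewrite [sc_count e p j1 m2]sc_count_eq0; last first.
  by apply: forall_cat (ret_not_sc _ _ op1) _ => i /idle2/not_sc.
rewrite [sc_count e p j2 j]sc_count_eq0; last first.
  by apply: forall_cat (ret_not_sc _ _ op2) _ => i /idle3/not_sc.
by rewrite add0n addn0 add0n leq_add.
Qed.

End Executions.

(** * Numbers of present, active and crashed nodes *)

Section Population.
Context {R : realType} {d : Order.disp_t} {L : latticeType d}
        {node : choiceType} {S : Type}.
Variable e : execution R L node S.
Hypothesis Htimed : timed e.
Local Open Scope ring_scope.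
Local Open Scope classical_set_scope.

(** Only finitely many events occur up to time [t], so one finite set contains all their actors.
    Finiteness matters because [fset_set] sends an infinite set to the empty one. *)
Lemma finite_actors t : exists2 A : set node, finite_set A &
  forall (t' : R) a p, t' <= t -> actor a = Some p -> by_time e t' a -> A p.
Proof.
case: Htimed => _ mono unb; have [M tM] := unb t.
exists [set` pmap (fun n => actor (act e n)) (iota 0 M)]; first exact: finite_seq.
move=> t' a p t't Ea [n nt' En] /=; rewrite mem_pmap; apply/mapP; exists n.
  rewrite mem_iota /= add0n ltnNge; apply/negP => /mono Mn.
  by have := le_lt_trans (le_trans Mn (le_trans nt' t't)) tM; rewrite ltxx.
by rewrite En Ea.
Qed.

Lemma sub_card (A B : set node) : finite_set B -> A `<=` B -> (card A <= card B)%N.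
Proof.
move=> finB AB; have finA := sub_finite_set AB finB.
by apply: fsubset_leq_card; rewrite -fset_set_sub.
Qed.

(** The numbers of active nodes are bounded by the size of the finite set of actors up to [t'], so a
    maximum is attained. *)
Lemma max_active_exists t t' : t <= t' -> exists N, max_active e t t' N.
Proof.
move=> tt'; have [A finA subA] := finite_actors t'.
pose P N := `[< exists2 u, t <= u <= t' & card (active e u) = N >].
have exP : exists N, P N.
  by exists (card (active e t)); apply/asboolP; exists t; rewrite ?lexx.
have leP N : P N -> (N <= card A)%N.
  move=> /asboolP[u /andP[_ ut'] <-]; apply: sub_card => // p [[ent _] _].
  exact: subA ut' _ ent.
case: (ex_maxnP exP leP) => N /asboolP PN maxN; exists N; split=> // u tut'.
by apply: maxN; apply/asboolP; exists u.
Qed.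

Lemma card_present_le t :
  (card (present e t) <= card (active e t) + card (crashed e t))%N.
Proof.
have [A finA subA] := finite_actors t.
have fin_act : finite_set (active e t).
  by apply: sub_finite_set finA => p [[ent _] _]; exact: subA (lexx _) _ ent.
have fin_cr : finite_set (crashed e t).
  by apply: sub_finite_set finA => p cr; exact: subA (lexx _) _ cr.
apply: leq_trans (_ : card (active e t `|` crashed e t) <= _)%N.
  apply: sub_card; first by rewrite finite_setU.
  by move=> p pr; have [cr|ncr] := pselect (crashed e t p); [right|left].
by rewrite /card fset_setU // cardfsU leq_subr.
Qed.

End Population.

(** * The parameters and the constant of the cost bound *)

Section Params.
Local Open Scope ring_scope.

(** [0 < gamma] and [gamma_le] make [Zparam] positive, so [Delta] times the cube of [1 + alpha] is
    below the cube of [1 - alpha], itself below that of [1 + alpha]. *)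
Lemma Delta_lt1 (R : realType) (alpha Delta D gamma beta : R) (Nmin : nat) :
  admissible alpha Delta D gamma beta Nmin -> Delta < 1.
Proof.
case=> a0 /andP[D0 _] _ _ /andP[g0 _] _ _ _ gle _ _.
have a1 : 0 < (1 + alpha) ^+ 3 by rewrite exprn_gt0 // ltr_wpDl.
have : 0 < Zparam alpha Delta.
  by have := lt_le_trans g0 gle; rewrite pmulr_lgt0 // invr_gt0.
rewrite /Zparam subr_gt0 => lt1.
rewrite -(ltr_pM2r a1) mul1r; apply: lt_trans lt1 _.
have -> : (1 + alpha) ^+ 3 = (1 - alpha) ^+ 3 + (6 * alpha + 2 * alpha ^+ 3).
  by ring.
by rewrite ltrDl addr_gt0 // mulr_gt0 // exprn_gt0.
Qed.

(** At least a fraction [1 - Delta] of the present nodes is active. Choosing [M] before the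
    execution makes the final constant uniform. *)
Lemma present_le_active (R : realType) (alpha Delta D : R) (Nmin : nat) :
  Delta < 1 -> exists M : nat, forall d (L : latticeType d) (node : choiceType)
    (S : Type) (e : execution R L node S),
  timed e -> bounded_churn alpha Delta D Nmin e ->
  forall t, 0 <= t -> (card (present e t) <= M * card (active e t))%N.
Proof.
move=> D1; have D1' : 0 < 1 - Delta by rewrite subr_gt0.
(* A natural number above the inverse of the active fraction. *)
exists (Num.bound (1 - Delta)^-1) => d L node S e tm [_ crash _] t t0.
have le_pres := card_present_le tm t.
rewrite -(ler_nat R) natrM.
have invD : (1 - Delta)^-1 <= (Num.bound (1 - Delta)^-1)%:R.
  by apply/ltW/archi_boundP; rewrite invr_ge0 ltW.
apply: le_trans (ler_wpM2r (ler0n _ _) invD).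
rewrite mulrC ler_pdivlMr // mulrBr mulr1 lerBlDr.
move: le_pres; rewrite -(ler_nat R) natrD => /le_trans; apply.
by rewrite lerD2l mulrC crash.
Qed.

(** The factor 2 counts the Update and the Scan, [C] is their cost per present node, and [M]
    converts present into active nodes at the two starting times, both within the Propose. *)
Lemma gla_terminates (R : realType) (alpha Delta D : R) (Nmin C M : nat)
    d (L : latticeType d) (node : choiceType) (S : Type)
    (e : execution R L node S) :
  (forall t, 0 <= t -> (card (present e t) <= M * card (active e t))%N) ->
  gla_execution alpha Delta D Nmin C e -> termination (2 * (C * M)) e.
Proof.
move=> le_act [tm _ code fair _ lin term] p k inv_k nf.
have [j [m1 [m2 [op_j km1 km2 le_sc]]]] :=
  propose_completes code lin fair term nf inv_k.
exists j => //; have [kj _ _ _] := op_j; have [t0 mono _] := tm.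
have [N maxN] := max_active_exists tm (mono _ _ (ltnW kj)).
exists N => //; apply: leq_trans le_sc _.
have bound m : (k <= m < j)%N ->
    (C * card (present e (time e m)) <= C * M * N)%N.
  move=> /andP[km mj]; rewrite -mulnA leq_mul2l; apply/orP; right.
  apply: leq_trans (le_act _ (t0 m)) _; rewrite leq_mul2l; apply/orP; right.
  by case: maxN => _; apply; rewrite !mono // ltnW.
by rewrite -mulnA mul2n -addnn leq_add // bound.
Qed.

End Params.

Unset Implicit Arguments.

Theorem mainTheorem2 (R : realType) (d : Order.disp_t) (L : latticeType d)
    (node : choiceType) (S : Type)
    (alpha Delta D gamma beta : R) (Nmin : nat)
    (Hparams : admissible alpha Delta D gamma beta Nmin) (C : nat) :
  exists K : nat, forall e : execution R L node S,
    gla_execution alpha Delta D Nmin C e ->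
    validity e /\ consistency e /\ termination K e.
Proof.
have [M le_act] := present_le_active alpha D Nmin (Delta_lt1 Hparams).
exists (2 * (C * M)) => e gla; have [tm churn code _ _ lin _] := gla.
split; first exact: gla_validity.
split; first exact: gla_consistency.
by apply: gla_terminates gla; apply: le_act.
Qed.
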